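(* Let $\delta\ge 0$ and let $\{(\alpha^t,\beta^t,\lambda^t,y^t)\}_{t\in\mathbb{N}}$ be a sequence of iterates produced by the discrete-continuous ADMM algorithm (described in the context), under the standing assumptions (A1)--(A4) of the context. Then any limit point $(\alpha^*,\beta^*,\lambda^*,y^* )$ of this sequence is a ''discrete-continuous'' critical point of the discrete-continuous augmented Lagrangian $\mathfrak{L}_\rho$, i.e. it satisfies $0\in\partial(\ell(y_i^*;\cdot))(\beta_i^* )-\lambda_i^*$ for all $i\in\mathcal{V}$, $0\in\partial f(\alpha^* )+K^\top\lambda^*$, $K\alpha^*=\beta^*$, and $E_C(y^* )<\infty$ for all $C\in\mathcal{C}$.
   Context: Setting. $(\mathcal{V},\mathcal{C})$ is a finite hypergraph ($\mathcal{C}$ is a set of subsets of $\mathcal{V}$), $\mathcal{L}$ is a finite label set, $\mathcal{Y}=\mathcal{L}^{|\mathcal{V}|}$ is the set of labelings. For each $C\in\mathcal{C}$, $E_C:\mathcal{Y}\to\mathbb{R}\cup\{+\infty\}$ is an energy (depending only on the labels of vertices in $C$). $\ell:\mathcal{L}\times\mathbb{R}^{|\mathcal{L}|}\to\mathbb{R}$ is a loss function. $\Phi(X)$ is a feature matrix with $|\mathcal{V}|$ columns (the features may be infinite-dimensional), $K=\Phi(X)^\top\Phi(X)\in\mathbb{R}^{|\mathcal{V}|\times|\mathcal{V}|}$ is the kernel matrix, $K_i$ its $i$-th row. $h:[0,\infty)\to\mathbb{R}$ is strictly monotonically increasing and $f:\mathbb{R}^{|\mathcal{V}|\times|\mathcal{L}|}\to\mathbb{R}$,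 $f(\alpha)=h(\|\Phi(X)\alpha\|_F)$. For a matrix, the subscript $i$ denotes the $i$-th row; $\langle\cdot,\cdot\rangle$ is the Frobenius inner product. For $\rho>0$, $\alpha,\beta,\lambda\in\mathbb{R}^{|\mathcal{V}|\times|\mathcal{L}|}$, $y\in\mathcal{Y}$, the discrete-continuous augmented Lagrangian is $$\mathfrak{L}_\rho(\alpha,\beta,\lambda,y)=\sum_{i\in\mathcal{V}}\ell(y_i;\beta_i)+f(\alpha)+\sum_{C\in\mathcal{C}}E_C(y)+\langle\lambda,K\alpha-\beta\rangle+\frac{\rho}{2}\|K\alpha-\beta\|_F^2.$$ Standing assumptions. (A1) $f$ is lower-bounded, $L$-smooth (differentiable with $L$-Lipschitz gradient) and $m$-semiconvex for some $m>0$ ($f+\frac m2\|\cdot\|_F^2$ is convex). (A2) For every $k\in\mathcal{L}$, $\ell(k;\cdot)$ is lower-bounded. (A3) $K$ is surjective, i.e. the smallest eigenvalue $\sigma_{\min}(K^\top K)$ of $K^\top K$ is positive. (A4) After finitely many iterations the penalty parameter is kept fixed at a value $\rho$ (i.e. there is $T_0\ge1$ with $\rho_t=\rho$ for all $t\ge T_0$) satisfying $$\frac{L^2}{\rho\,\sigma_{\min}(K^\top K)}+\frac{m-\rho\,\sigma_{\min}(K^\top K)}{2}<0.\qquad(\ast)$$ Algorithm (discrete-continuous ADMM) with parameter $\delta\ge0$. Initialize $\alpha^0,\lambda^0$, $\rho_0>0$, $\tau>1$, and $\rho_{\max}$ satisfying $(\ast)$; $y^0\in\mathcal{Y}$ denotes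 the starting labeling. At iteration $t$, with penalty $\rho_t$ (written $\rho$ in the following steps): 1. For each $i\in\mathcal{V}$, $k\in\mathcal{L}$ let $B^{t+1}_{i,k}\in\mathbb{R}^{|\mathcal{L}|}$ be a minimizer, and $u^{t+1}_{i,k}$ the minimum value, over $b\in\mathbb{R}^{|\mathcal{L}|}$ of $\ell(k;b)+\frac{\rho}{2}\|b-K_i\alpha^t-\lambda_i^t/\rho\|^2$. For $y\in\mathcal{Y}$ let $B^{t+1}_{:,y}$ be the matrix with $i$-th row $B^{t+1}_{i,y_i}$. 2. Choose a candidate $\hat y\in\mathcal{Y}$ as a (possibly suboptimal) solution of $\min_{y\in\mathcal{Y}}\sum_i u^{t+1}_{i,y_i}+\sum_C E_C(y)$. If $\mathfrak{L}_\rho(\alpha^t,B^{t+1}_{:,\hat y},\lambda^t,\hat y)-\mathfrak{L}_\rho(\alpha^t,B^{t+1}_{:,y^t},\lambda^t,y^t)\le-\delta$, set $y^{t+1}=\hat y$; otherwise set $y^{t+1}=y^t$. 3. $\beta^{t+1}=B^{t+1}_{:,y^{t+1}}$. 4. $\alpha^{t+1}\in\arg\min_\alpha\mathfrak{L}_\rho(\alpha,\beta^{t+1},\lambda^t,y^{t+1})$. 5. $\lambda^{t+1}=\lambda^t+\rho(K\alpha^{t+1}-\beta^{t+1})$. 6. If $\rho_t$ violates $(\ast)$, set $\rho_{t+1}=\min\{\rho_{\max},\tau\rho_t\}$; otherwise $\rho_{t+1}=\rho_t$. $\partial$ denotes the limiting (Mordukhovich) subdifferential in the sense of Rockafellar--Wets,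 Variational Analysis, Definition 8.3.
   Formalization: The formal theorem also assumes that the proximal problems of step 1 have minimizers for every penalty ρ>0 and every centre, and that the acceptance test of step 2 never compares +∞ with +∞; the claim fails or is undefined without these. *)

(* Defs.v *)
From HB Require Import structures.
From mathcomp Require Import all_boot all_order all_algebra.
From mathcomp Require Import all_classical all_reals all_analysis.

Set Implicit Arguments.
Unset Strict Implicit.
Unset Printing Implicit Defensive.

Import Order.TTheory GRing.Theory Num.Theory.
Import numFieldNormedType.Exports.

Local Open Scope classical_set_scope.
Local Open Scope ring_scope.

Definition is_argmin {T : Type} {d : Order.disp_t} {U : porderType d}
    (g : T -> U) (x : T) : Prop :=
  forall z, (g x <= g z)%O.

Definition limit_point_of {T : topologicalType} (u : nat -> T) (z : T) : Prop :=
  exists s : nat -> nat, {homo s : i j / (i < j)%N} /\ (u \o s) @ \oo --> z.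

(* The library norm on matrices is the maximum norm. It is used below only
   through the topology it induces; every metric quantity is stated with the
   Frobenius norm, which on 'rV_q is the Euclidean norm. *)
Definition frob {R : realType} {p q : nat} (A B : 'M[R]_(p, q)) : R :=
  \tr (A^T *m B).

Definition normF {R : realType} {p q : nat} (A : 'M[R]_(p, q)) : R :=
  Num.sqrt (frob A A).

Section functions_on_matrices.
Context {R : realType} {p q : nat}.
Implicit Types (g : 'M[R]_(p, q) -> R) (x v : 'M[R]_(p, q)).

(* The Riesz representative of the differential for [frob]. *)
Definition gradient g x : 'M[R]_(p, q) :=
  \matrix_(i, j) 'd g x (delta_mx i j).

Definition smooth (L : R) g : Prop :=
  (forall x, differentiable g x) /\
  (forall x z, normF (gradient g x - gradient g z) <= L * normF (x - z)).

Definition semiconvex (m : R) g : Prop :=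
  convex_function setT (fun x => g x + m / 2 * normF x ^+ 2).

Definition lower_bounded g : Prop := has_lbound (range g).

(* The epsilon form of g z >= g x + <v, z - x> + o(|z - x|). *)
Definition regular_subdifferential g x : set 'M[R]_(p, q) :=
  [set v | forall e : R, 0 < e -> \forall z \near x,
     g x + frob v (z - x) - e * normF (z - x) <= g z].

(* Rockafellar-Wets, Definition 8.3(b), for a real-valued function. *)
Definition limiting_subdifferential g x : set 'M[R]_(p, q) :=
  [set v | exists xs vs : nat -> 'M[R]_(p, q),
     [/\ xs @ \oo --> x,
         (g \o xs) @ \oo --> g x,
         forall nu, regular_subdifferential g (xs nu) (vs nu)
       & vs @ \oo --> v]].

End functions_on_matrices.

Definition is_smallest_eigenvalue {R : realType} {n : nat} (A : 'M[R]_n)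
    (s : R) : Prop :=
  eigenvalue A s /\ (forall a, eigenvalue A a -> s <= a).

(* Phi(X) is a family of n columns [phi i] in a real inner product space H,
   which may be infinite-dimensional. Column k of Phi(X) alpha is
   \sum_i alpha i k *: phi i. *)
Section features.
Context {R : realType} {n q : nat} {H : lmodType R} (ip : {dot H for idfun})
  (phi : 'I_n -> H).

Definition kernel_mx : 'M[R]_n := \matrix_(i, j) ip (phi i) (phi j).

Definition feature_normF (alpha : 'M[R]_(n, q)) : R :=
  Num.sqrt (\sum_(k < q)
    ip (\sum_(i < n) alpha i k *: phi i) (\sum_(i < n) alpha i k *: phi i)).

Definition regularizer (h : R -> R) (alpha : 'M[R]_(n, q)) : R :=
  h (feature_normF alpha).

End features.

Section admm.
Context {R : realType} {n q : nat}.
Notation labeling := {ffun 'I_n -> 'I_q}.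

Variant energies (CC : {set {set 'I_n}}) (E : {set 'I_n} -> labeling -> \bar R)
    : Prop := Energies of
  (forall C (y : labeling), C \in CC -> E C y != -oo%E) &
  (forall C (y y' : labeling), C \in CC -> {in C, y =1 y'} -> E C y = E C y').

Context (ell : 'I_q -> 'rV[R]_q -> R) (f : 'M[R]_(n, q) -> R) (K : 'M[R]_n)
  (CC : {set {set 'I_n}}) (E : {set 'I_n} -> labeling -> \bar R).

Definition aug_lagrangian (rho : R) (alpha beta lambda : 'M[R]_(n, q))
    (y : labeling) : \bar R :=
  ((\sum_(i < n) ell (y i) (row i beta))%:E + (f alpha)%:E
   + \sum_(C in CC) E C y
   + (frob lambda (K *m alpha - beta))%:E
   + (rho / 2 * normF (K *m alpha - beta) ^+ 2)%:E)%E.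

Definition prox_objective (k : 'I_q) (rho : R) (c b : 'rV[R]_q) : R :=
  ell k b + rho / 2 * normF (b - c) ^+ 2.

(* The proximal subproblems of the algorithm have minimizers whatever the
   penalty and the centre, i.e. its first step can be carried out from every
   initialization. *)
Definition prox_solvable : Prop :=
  forall k rho c, 0 < rho -> exists b, is_argmin (prox_objective k rho c) b.

Definition penalty_condition (L m sigma rho : R) : Prop :=
  L ^+ 2 / (rho * sigma) + (m - rho * sigma) / 2 < 0.

Definition assemble (B : 'I_n -> 'I_q -> 'rV[R]_q) (y : labeling)
    : 'M[R]_(n, q) :=
  \matrix_(i < n, j < q) B i (y i) 0 j.

(* [beta 0] is not set by the algorithm and is left unconstrained, as are the
   candidates [yhat]: they are possibly suboptimal solutions of the discrete
   problem, so the values u of the proximal subproblems do not occur.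
   [admm_test_defined] says that the difference in the acceptance test is not of
   the form +oo - (+oo); it holds for instance when [y 0] has finite energy. *)
Record dc_admm (delta L m sigma tau rho_max : R)
    (alpha beta lambda : nat -> 'M[R]_(n, q)) (y yhat : nat -> labeling)
    (rho : nat -> R) (B : nat -> 'I_n -> 'I_q -> 'rV[R]_q) : Prop := DcAdmm {
  admm_rho0 : 0 < rho 0%N ;
  admm_tau : 1 < tau ;
  admm_rho_max : 0 < rho_max /\ penalty_condition L m sigma rho_max ;
  admm_prox : forall t i k,
    is_argmin (prox_objective k (rho t)
                 (row i (K *m alpha t) + (rho t)^-1 *: row i (lambda t)))
              (B t.+1 i k) ;
  admm_test_defined : forall t,
    (aug_lagrangian (rho t) (alpha t) (assemble (B t.+1) (yhat t.+1))
       (lambda t) (yhat t.+1)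
     +? - aug_lagrangian (rho t) (alpha t) (assemble (B t.+1) (y t))
            (lambda t) (y t))%E ;
  admm_label : forall t,
    y t.+1 =
      if (aug_lagrangian (rho t) (alpha t) (assemble (B t.+1) (yhat t.+1))
            (lambda t) (yhat t.+1)
          - aug_lagrangian (rho t) (alpha t) (assemble (B t.+1) (y t))
              (lambda t) (y t)
          <= (- delta)%:E)%E
      then yhat t.+1 else y t ;
  admm_beta : forall t, beta t.+1 = assemble (B t.+1) (y t.+1) ;
  admm_alpha : forall t,
    is_argmin (fun a => aug_lagrangian (rho t) a (beta t.+1) (lambda t) (y t.+1))
              (alpha t.+1) ;
  admm_lambda : forall t,
    lambda t.+1 = lambda t + rho t *: (K *m alpha t.+1 - beta t.+1) ;
  admm_rho : forall t,
    (~ penalty_condition L m sigma (rho t) ->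
       rho t.+1 = Num.min rho_max (tau * rho t)) /\
    (penalty_condition L m sigma (rho t) -> rho t.+1 = rho t)
}.

Definition dc_critical_point (alpha beta lambda : 'M[R]_(n, q)) (y : labeling)
    : Prop :=
  [/\ forall i : 'I_n,
        [set v - row i lambda
           | v in limiting_subdifferential (ell (y i)) (row i beta)] 0,
      [set v + K^T *m lambda | v in limiting_subdifferential f alpha] 0,
      K *m alpha = beta
    & forall C, C \in CC -> (E C y < +oo)%E].

End admm.

(* Main.v *)
(* The labels have finite energy from the first iteration on, since the test of
   the second step never compares two infinite values. Once the penalty is
   fixed, optimality of alpha gives grad f(alpha) = - K^T lambda, so that
   sigma |dlambda|^2 <= L^2 |dalpha|^2, where sigma is the minimal Rayleigh
   quotient of K^T K. The alpha-step decreases the augmented Lagrangian by at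
   least (rho sigma - m) / 2 |dalpha|^2 and the lambda-step increases it by
   |dlambda|^2 / rho; by the penalty condition the balance is negative. Along a
   convergent subsequence the Lagrangian is bounded below, hence dalpha and
   dlambda tend to 0, the limit is feasible, and the optimality conditions of the
   subproblems pass to the limit. *)
Require Import Defs.
From HB Require Import structures.
From mathcomp Require Import all_boot all_order all_algebra.
From mathcomp Require Import all_classical all_reals all_analysis.
From mathcomp Require Import ring lra.

Set Implicit Arguments.
Unset Strict Implicit.
Unset Printing Implicit Defensive.

Import Order.TTheory GRing.Theory Num.Theory.
Import numFieldNormedType.Exports.

Local Open Scope classical_set_scope.
Local Open Scope ring_scope.

(** * The Frobenius inner product and its norm *)

Section frobenius.
Context {R : realType} {p q : nat}.
Implicit Types A B C : 'M[R]_(p, q).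

Lemma frobE A B : frob A B = \sum_(i < p) \sum_(j < q) A i j * B i j.
Proof.
rewrite /frob /mxtrace exchange_big; apply: eq_bigr => j _ /=.
by rewrite mxE; apply: eq_bigr => i _; rewrite mxE.
Qed.

Lemma frobC A B : frob A B = frob B A.
Proof.
by rewrite !frobE; apply: eq_bigr => i _; apply: eq_bigr => j _; rewrite mulrC.
Qed.

Lemma frobDr A B C : frob A (B + C) = frob A B + frob A C.
Proof. by rewrite /frob mulmxDr mxtraceD. Qed.

Lemma frobDl A B C : frob (A + B) C = frob A C + frob B C.
Proof. by rewrite frobC frobDr !(frobC C). Qed.

Lemma frobZr a A B : frob A (a *: B) = a * frob A B.
Proof. by rewrite /frob -scalemxAr mxtraceZ. Qed.

Lemma frobZl a A B : frob (a *: A) B = a * frob A B.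
Proof. by rewrite frobC frobZr frobC. Qed.

Lemma frob0r A : frob A 0 = 0.
Proof. by rewrite /frob mulmx0 mxtrace0. Qed.

Lemma frobNr A B : frob A (- B) = - frob A B.
Proof. by rewrite -scaleN1r frobZr mulN1r. Qed.

Lemma frobNl A B : frob (- A) B = - frob A B.
Proof. by rewrite frobC frobNr frobC. Qed.

Definition frob_bilin := (frobDl, frobDr, frobNl, frobNr, frobZl, frobZr).

Lemma frob_mulmxr (M : 'M[R]_p) A B : frob A (M *m B) = frob (M^T *m A) B.
Proof. by rewrite /frob trmx_mul trmxK mulmxA. Qed.

Lemma frob_ge0 A : 0 <= frob A A.
Proof.
by rewrite frobE; apply: sumr_ge0 => i _; apply: sumr_ge0 => j _; rewrite -expr2 sqr_ge0.
Qed.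

Lemma coord_sqr_le_frob A i j : A i j ^+ 2 <= frob A A.
Proof.
rewrite frobE (bigD1 i) //= (bigD1 j) //= -expr2 -addrA lerDl addr_ge0 //.
  by apply: sumr_ge0 => l _; rewrite -expr2 sqr_ge0.
by apply: sumr_ge0 => k _; apply: sumr_ge0 => l _; rewrite -expr2 sqr_ge0.
Qed.

Lemma frob_eq0 A : frob A A <= 0 -> A = 0.
Proof.
move=> A0; apply/matrixP => i j; rewrite mxE; apply/eqP; rewrite -sqrf_eq0.
by rewrite eq_le sqr_ge0 (le_trans (coord_sqr_le_frob A i j) A0).
Qed.

Lemma sqr_normF A : normF A ^+ 2 = frob A A.
Proof. by rewrite sqr_sqrtr ?frob_ge0. Qed.

Lemma normF_ge0 A : 0 <= normF A.
Proof. exact: sqrtr_ge0. Qed.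

Lemma normFZ a A : normF (a *: A) = `|a| * normF A.
Proof.
by rewrite /normF !frob_bilin mulrA -expr2 sqrtrM ?sqr_ge0 // sqrtr_sqr.
Qed.

Lemma normF_distC A B : normF (A - B) = normF (B - A).
Proof. by rewrite -[A - B]opprB /normF frobNl frobNr opprK. Qed.

Lemma coord_le_normF A i j : `|A i j| <= normF A.
Proof. by rewrite -sqrtr_sqr ler_wsqrtr ?coord_sqr_le_frob. Qed.

Lemma norm_le_normF A : `|A| <= normF A.
Proof.
rewrite [`|A|]mx_normrE; apply/bigmax_leP; split; first exact: normF_ge0.
by move=> i _; exact: coord_le_normF.
Qed.

End frobenius.

Lemma frob_rows {R : realType} {p q : nat} (A B : 'M[R]_(p, q)) :
  frob A B = \sum_(i < p) frob (row i A) (row i B).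
Proof.
rewrite frobE; apply: eq_bigr => i _; rewrite frobE big_ord1.
by apply: eq_bigr => j _; rewrite !mxE.
Qed.

(** * Convergence of matrices *)

Lemma cvg_sum {R : realType} {T : Type} {F : set_system T} {FF : Filter F}
    (I : finType) (u : I -> T -> R) (a : I -> R) :
  (forall i, u i @ F --> a i) -> (fun t => \sum_i u i t) @ F --> \sum_i a i.
Proof. by move=> ua; by apply: (@cvg_big _ _ +%R) => //; exact: add_continuous. Qed.

Section matrix_convergence.
Context {R : realType} {T : Type} {F : set_system T} {FF : Filter F}.

Lemma cvg_coord p q (A : T -> 'M[R]_(p, q)) (a : 'M[R]_(p, q)) i j :
  A @ F --> a -> (fun t => A t i j) @ F --> a i j.
Proof. move=> Aa; have ca : (fun M : 'M[R]_(p, q) => M i j) @ a --> a i j.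
  exact: coord_continuous.
exact: (cvg_comp _ _ Aa ca). Qed.

Lemma cvg_frob p q (A B : T -> 'M[R]_(p, q)) (a b : 'M[R]_(p, q)) :
  A @ F --> a -> B @ F --> b -> (fun t => frob (A t) (B t)) @ F --> frob a b.
Proof.
move=> Aa Bb; under eq_cvg do rewrite frobE.
rewrite frobE; apply: cvg_sum => i; apply: cvg_sum => j.
by apply: cvgM; exact: cvg_coord.
Qed.

(** The topology is that of the maximum norm, which the Frobenius norm dominates. *)
Lemma cvg_mx_frob0 p q (A : T -> 'M[R]_(p, q)) (a : 'M[R]_(p, q)) :
  (fun t => frob (A t - a) (A t - a)) @ F --> 0 -> A @ F --> a.
Proof.
move=> A0; apply/cvgrPdist_lt => e e0.
have e20 : 0 < e ^+ 2 by rewrite exprn_gt0.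
move/cvgr0Pnorm_lt: A0 => /(_ _ e20); apply: filterS => t.
rewrite ger0_norm ?frob_ge0 // -sqr_normF ltr_pXn2r ?nnegrE ?normF_ge0 1?ltW //.
by move=> At; rewrite distrC (le_lt_trans (norm_le_normF _)).
Qed.

Lemma cvg_mx_coord p q (A : T -> 'M[R]_(p, q)) (a : 'M[R]_(p, q)) :
  (forall i j, (fun t => A t i j) @ F --> a i j) -> A @ F --> a.
Proof.
move=> Aa; apply: cvg_mx_frob0.
suff: (fun t => \sum_i \sum_j (A t - a) i j * (A t - a) i j) @ F -->
    \sum_(i < p) \sum_(j < q) (0 * 0 : R).
  rewrite [X in _ --> X -> _]big1 => [|i _]; last first.
    by rewrite big1 // => j _; rewrite mul0r.
  by under [X in _ -> X]eq_cvg do rewrite frobE.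
apply: cvg_sum => i; apply: cvg_sum => j.
have A0 : (fun t => (A t - a) i j) @ F --> (0 : R).
  rewrite -(subrr (a i j)) (_ : (fun t => _) = (fun t => A t i j - a i j)).
    by apply: cvgB => //; exact: cvg_cst.
  by apply/funext => t; rewrite !mxE.
exact: (cvgM A0 A0).
Qed.

Lemma cvg_mulmx p q r (M : 'M[R]_(r, p)) (A : T -> 'M[R]_(p, q))
    (a : 'M[R]_(p, q)) :
  A @ F --> a -> (fun t => M *m A t) @ F --> M *m a.
Proof.
move=> Aa; apply: cvg_mx_coord => i j; rewrite mxE; under eq_cvg do rewrite mxE.
by apply: cvg_sum => k; apply: cvgM; [exact: cvg_cst | exact: cvg_coord].
Qed.

Lemma cvg_row p q (A : T -> 'M[R]_(p, q)) (a : 'M[R]_(p, q)) i :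
  A @ F --> a -> (fun t => row i (A t)) @ F --> row i a.
Proof.
move=> Aa; apply: cvg_mx_coord => k j; rewrite mxE; under eq_cvg do rewrite mxE.
exact: cvg_coord.
Qed.

End matrix_convergence.

(** The comparison in the other direction needs no equivalence constant: [frob] is continuous, so
    Frobenius balls are neighbourhoods. *)
Lemma near_normF_lt {R : realType} {p q : nat} (x : 'M[R]_(p, q)) (e : R) :
  0 < e -> \forall z \near x, normF (z - x) < e.
Proof.
move=> e0; have e20 : 0 < e ^+ 2 by rewrite exprn_gt0.
have zx : (fun z : 'M[R]_(p, q) => z - x) @ x --> x - x.
  exact: (cvgB (@cvg_id _ _) (cvg_cst x)).
have zx0 : (fun z : 'M[R]_(p, q) => frob (z - x) (z - x)) @ x --> (0 : R).
  have <- : frob (x - x) (x - x) = 0 by rewrite subrr frob0r.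
  exact: (cvg_frob zx zx).
have := (cvgr0Pnorm_lt (FF := nbhs_filter x) _).1 zx0 _ e20.
apply: filterS => z; rewrite ger0_norm ?frob_ge0 // -sqr_normF.
by rewrite ltr_pXn2r ?nnegrE ?normF_ge0 1?ltW.
Qed.

(** * Rayleigh quotients and the smallest eigenvalue *)

Lemma frob_tr {R : realType} {p q : nat} (A B : 'M[R]_(p, q)) :
  frob A^T B^T = frob A B.
Proof.
rewrite !frobE exchange_big /=; apply: eq_bigr => i _.
by apply: eq_bigr => j _; rewrite !mxE.
Qed.

Lemma frob_mulmxl {R : realType} {p q : nat} (M : 'M[R]_q) (A B : 'M[R]_(p, q)) :
  frob A (B *m M) = frob (A *m M^T) B.
Proof. by rewrite -frob_tr trmx_mul frob_mulmxr trmxK -(frob_tr _ B) trmx_mul trmxK. Qed.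

Section rayleigh.
Context {R : realType} {n : nat} (A : 'M[R]_n) (A_sym : A^T = A).

Let quad (u : 'rV[R]_n) : R := frob u (u *m A).

Let quad_continuous : continuous quad.
Proof.
move=> u; have uA : (fun v : 'rV[R]_n => v *m A) @ u --> u *m A.
  apply: (cvg_mx_coord (FF := nbhs_filter u)) => i j.
  rewrite mxE; under eq_cvg do rewrite mxE.
  apply: (cvg_sum (FF := nbhs_filter u)) => k.
  by apply: cvgM; [exact: coord_continuous | exact: cvg_cst].
exact: (cvg_frob (FF := nbhs_filter u) (@cvg_id _ _) uA).
Qed.

Let sphere_compact : compact [set u : 'rV[R]_n | frob u u = 1].
Proof.
apply: bounded_closed_compact.
  exists 1; split; first exact: num_real.
  move=> M M1 u /= u1; rewrite (le_trans (norm_le_normF u)) //.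
  by rewrite /normF u1 sqrtr1 ltW.
apply: (@closed_comp _ _ (fun u : 'rV[R]_n => frob u u) [set 1]).
  by move=> u _; exact: (cvg_frob (FF := nbhs_filter u) (@cvg_id _ _) (@cvg_id _ _)).
exact: closed_eq.
Qed.

(** The quotient is invariant under scaling, so its minimum over the compact unit sphere is global;
    [v] shows that the sphere is nonempty. *)
Lemma rayleigh_min (v : 'rV[R]_n) : v != 0 ->
  exists c : 'rV[R]_n, frob c c = 1 /\ forall u, quad c * frob u u <= quad u.
Proof.
move=> v0.
have unit_sphere (u : 'rV[R]_n) : u != 0 ->
    frob ((normF u)^-1 *: u) ((normF u)^-1 *: u) = 1.
  move=> u0; rewrite !frob_bilin mulrA -expr2 -sqr_normF -exprMn mulVf ?expr1n //.
  apply: contra_neq u0 => nu0; apply: frob_eq0.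
  by rewrite -sqr_normF nu0 expr0n.
have [||c] := @EVT_min_rV _ _ quad _ _ sphere_compact.
- by exists ((normF v)^-1 *: v); exact: unit_sphere.
- exact: continuous_subspaceT.
rewrite inE /= => c1 cmin; exists c; split=> // u.
have [->|u0] := eqVneq u 0; first by rewrite /quad mul0mx frob0r mulr0.
have := cmin ((normF u)^-1 *: u); rewrite inE /= => /(_ (unit_sphere u u0)).
rewrite {2}/quad -scalemxAl !frob_bilin mulrA -expr2 -/(quad u) -sqr_normF.
have nu0 : 0 < normF u.
  rewrite lt_def normF_ge0 andbT; apply: contra_neq u0 => nu0.
  by apply: frob_eq0; rewrite -sqr_normF nu0 expr0n.
by rewrite exprVn ler_pdivlMl ?exprn_gt0 // mulrC.
Qed.

(** Moving [c] along the residual [w] of the eigenvalue equation would lower the quotient unless [w]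
    vanishes. *)
Lemma rayleigh_eigenvalue (c : 'rV[R]_n) : frob c c = 1 ->
  (forall u, quad c * frob u u <= quad u) -> eigenvalue A (quad c).
Proof.
move=> c1 cmin; apply/eigenvalueP; exists c; last first.
  by apply/eqP => c0; move: c1; rewrite c0 frob0r => /eqP; rewrite eq_sym oner_eq0.
apply/eqP; rewrite -subr_eq0; apply/eqP/frob_eq0.
set w := _ - _; have cA : c *m A = w + quad c *: c by rewrite subrK.
clearbody w; set N := frob w w; pose D := quad w - quad c * N.
have D0 : 0 <= D by rewrite subr_ge0 cmin.
have D10 : D + 1 != 0 by rewrite gt_eqF // ltr_wpDl.
(* Minimality at [c + t *: w] reads [0 <= 2 t N + t^2 D]. This [t] turns the right side into
   [- t^2 (D + 2)]; the summand 1 keeps the denominator positive when [D] is 0. *)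
pose t := - N / (D + 1); have tN : N = - (t * (D + 1)) by rewrite mulfVK ?opprK.
have cross : frob w (c *m A) = quad c * frob c w + N.
  by rewrite cA frobDr frobZr (frobC w c) addrC.
have := cmin (c + t *: w).
have -> : quad (c + t *: w) = quad c + t * frob w (c *m A) *+ 2 + t ^+ 2 * quad w.
  rewrite /quad mulmxDl -scalemxAl !frob_bilin.
  have -> : frob c (w *m A) = frob w (c *m A) by rewrite frob_mulmxl A_sym frobC.
  ring.
rewrite !frob_bilin c1 (frobC w c) cross -/N => H.
have {}H : 0 <= - t ^+ 2 * (D + 2).
  have -> : - t ^+ 2 * (D + 2) = t * N * 2 + t ^+ 2 * D by rewrite {1}tN; ring.
  rewrite /D; move: H; lra.
have t0 : t = 0 by apply/eqP; rewrite -sqrf_eq0 eq_le sqr_ge0 andbT; nra.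
by rewrite tN t0 mul0r oppr0.
Qed.

(** The minimal Rayleigh quotient is itself an eigenvalue, hence at least [s]. *)
Lemma smallest_eigenvalue_le (s : R) (v : 'rV[R]_n) :
  is_smallest_eigenvalue A s -> s * frob v v <= frob v (v *m A).
Proof.
move=> [_ smin]; have [->|v0] := eqVneq v 0; first by rewrite mul0mx frob0r mulr0.
have [c [c1 cmin]] := rayleigh_min v0.
apply: le_trans (cmin v); rewrite ler_wpM2r ?frob_ge0 // smin //.
exact: rayleigh_eigenvalue.
Qed.

End rayleigh.

Lemma smallest_eigenvalue_mulmx {R : realType} {n q : nat} (K : 'M[R]_n)
    (s : R) (X : 'M[R]_(n, q)) :
  is_smallest_eigenvalue (K^T *m K) s -> s * frob X X <= frob (K *m X) (K *m X).
Proof.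
move=> sK; have symK : (K^T *m K)^T = K^T *m K by rewrite trmx_mul trmxK.
rewrite -(frob_tr X) -(frob_tr (K *m X)) trmx_mul !(frob_rows _ (_ ^T)) frob_rows.
rewrite mulr_sumr; apply: ler_sum => j _; rewrite row_mul.
rewrite (le_trans (smallest_eigenvalue_le symK (row j X^T) sK)) //.
by rewrite mulmxA frob_mulmxl.
Qed.

(** * Gradients, subdifferentials and first-order optimality *)

Section gradients.
Context {R : realType} {p q : nat} (f : 'M[R]_(p, q) -> R).

Lemma diff_gradient x v : 'd f x v = frob (gradient f x) v.
Proof.
rewrite {1}[v]matrix_sum_delta linear_sum frobE; apply: eq_bigr => i _.
rewrite linear_sum; apply: eq_bigr => j _.
by rewrite linearZ mxE mulrC.
Qed.

(** The remainder is little-o of the maximum norm, hence also of the larger Frobenius norm. *)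
Lemma gradient_expansion x (e : R) : differentiable f x -> 0 < e ->
  nbhs x [set z : 'M[R]_(p, q) |
    `|f z - f x - frob (gradient f x) (z - x)| <= e * normF (z - x)].
Proof.
move=> df e0.
have := diff_locally df; set k := (X in _ = _ + X) => fE.
have kE h : f (h + x) - f x - frob (gradient f x) h = k h.
  by rewrite -[f (h + x)]/((f \o shift x) h) fE /= !fctE diff_gradient; ring.
have near0 : nbhs (0 : 'M[R]_(p, q)) [set h : 'M[R]_(p, q) |
    `|f (h + x) - f x - frob (gradient f x) h| <= e * normF h].
  have H := littleoP [littleo of k] e0.
  apply: (@filterS _ (nbhs 0) (nbhs_filter 0) _ _ _ H) => h /=.
  by rewrite kE => /le_trans; apply; rewrite ler_pM2l // norm_le_normF.
have zx : (fun z : 'M[R]_(p, q) => z - x) @ x --> x - x.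
  exact: (cvgB (@cvg_id _ _) (cvg_cst x)).
rewrite -(subrr x) in near0; have := zx _ near0.
apply: (@filterS _ (nbhs x) (nbhs_filter x)) => z /=.
by rewrite subrK.
Qed.

Lemma gradient_regular x : differentiable f x ->
  regular_subdifferential f x (gradient f x).
Proof.
move=> df e e0; have H := gradient_expansion df e0.
apply: (@filterS _ (nbhs x) (nbhs_filter x) _ _ _ H) => z /=.
rewrite ler_norml => /andP[+ _]; lra.
Qed.

Lemma gradient_limiting x : differentiable f x ->
  limiting_subdifferential f x (gradient f x).
Proof.
move=> df; exists (cst x), (cst (gradient f x)).
split; [exact: cvg_cst | | by move=> ?; exact: gradient_regular | exact: cvg_cst].
have -> : f \o cst x = cst (f x) by []; exact: cvg_cst.
Qed.

(** If [G], the sum of the gradient and [w], were nonzero, a short step along [- G] would gain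
    [t |G|^2] to first order, more than the remainder and the quadratic term can offset. *)
Lemma gradient_at_min x w (M : 'M[R]_p) (c : R) : differentiable f x ->
  (forall z, f x <= f z + frob w (z - x) + c * frob (M *m (z - x)) (M *m (z - x))) ->
  gradient f x = - w.
Proof.
move=> df fmin; apply/eqP; rewrite -subr_eq0 opprK; apply/eqP/frob_eq0.
set G := _ + _.
have gw : frob (gradient f x) G + frob w G = frob G G by rewrite -frobDl.
clearbody G; rewrite leNgt; apply/negP => G0.
have nG0 : 0 < normF G by rewrite sqrtr_gt0.
have e0 : 0 < normF G / 4 by rewrite divr_gt0.
have H := gradient_expansion df e0.
have path_cvg : (fun t : R => x - t *: G) @ (0 : R)^'+ --> x.
  rewrite -[X in _ --> X]subr0 -(scale0r G); apply: cvgB; first exact: cvg_cst.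
  apply: cvgZr_tmp; apply: cvg_at_right_filter; exact: cvg_id.
pose C := c * frob (M *m G) (M *m G).
have C0 : 0 < `|C| + 1 by rewrite ltr_wpDl.
(* For such a [t] the remainder and the quadratic term are each at most a quarter of the gain
   [t * frob G G]. *)
have [|t [[/= t0 tC] /= tH]] := @filter_ex _ ((0 : R)^'+) _
  ([set t | 0 < t] `&` [set t | t < frob G G / 4 / (`|C| + 1)] `&`
   [set t | `|f (x - t *: G) - f x - frob (gradient f x) (x - t *: G - x)|
     <= normF G / 4 * normF (x - t *: G - x)]).
  apply: filterI; last exact: (path_cvg _ H).
  apply: filterI; first exact: nbhs_right_gt.
  by apply: nbhs_right_lt; rewrite !divr_gt0.
have E : x - t *: G - x = (- t) *: G by rewrite addrAC subrr add0r scaleNr.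
have := fmin (x - t *: G); move: tH.
rewrite E -scalemxAr normFZ normrN (gtr0_norm t0) !frob_bilin ler_norml.
have -> : normF G / 4 * (t * normF G) = t * frob G G / 4.
  by rewrite -sqr_normF; ring.
move=> /andP[_ up] lo.
have tC' : t * C <= frob G G / 4.
  move: tC; rewrite ltr_pdivlMr // => /ltW; apply: le_trans.
  by rewrite ler_pM2l // (le_trans (ler_norm C)) // lerDl.
have ttC : t * (t * C) <= t * (frob G G / 4) by rewrite ler_pM2l.
have : 0 < t * frob G G by rewrite mulr_gt0.
have : t * (frob (gradient f x) G + frob w G) = t * frob G G by rewrite gw.
have : c * (- t * (- t * frob (M *m G) (M *m G))) = t * (t * C).
  by rewrite /C; ring.
move: up lo ttC; lra.
Qed.

End gradients.

(** * Proximal subproblems *)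

(** Expanding the square around [b] leaves the linear term and [rho / 2 |z - b|^2], which is at most
    [e |z - b|] within distance [2 e / rho]. *)
Lemma prox_normal {R : realType} {q : nat} (ell : 'I_q -> 'rV[R]_q -> R) k
    (rho : R) (c b : 'rV[R]_q) :
  0 < rho -> is_argmin (prox_objective ell k rho c) b ->
  regular_subdifferential (ell k) b (rho *: (c - b)).
Proof.
move=> rho0 bmin e e0; have e20 : 0 < 2 * e / rho by rewrite divr_gt0 ?mulr_gt0.
have H := near_normF_lt b e20.
apply: (@filterS _ (nbhs b) (nbhs_filter b) _ _ _ H) => z /=.
rewrite ltr_pdivlMr // => zb.
have zb2 : rho / 2 * normF (z - b) ^+ 2 <= e * normF (z - b).
  by have := normF_ge0 (z - b); nra.
have := bmin z; rewrite /prox_objective !sqr_normF => bz.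
have E : frob (z - c) (z - c) =
    frob (b - c) (b - c) - 2 * frob (c - b) (z - b) + normF (z - b) ^+ 2.
  rewrite sqr_normF !frob_bilin (frobC z c) (frobC z b) (frobC b c); ring.
move: bz; rewrite E frobZl; lra.
Qed.

(* Lower semicontinuity of [ell k] is not assumed. The minimizer of the proximal
   problem with penalty 2 rho centred at (c + bl) / 2, which is the limiting
   proximal problem plus a multiple of |z - bl|^2, can only be bl; this gives
   the lower bound on the values. *)
Lemma prox_values_cvg {R : realType} {q : nat} (ell : 'I_q -> 'rV[R]_q -> R) k
    (rho : R) (b c : nat -> 'rV[R]_q) (bl cl : 'rV[R]_q) :
  prox_solvable ell -> 0 < rho ->
  (\forall j \near \oo, is_argmin (prox_objective ell k rho (c j)) (b j)) ->
  b @ \oo --> bl -> c @ \oo --> cl -> (ell k \o b) @ \oo --> ell k bl.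
Proof.
move=> solv rho0 bmin bbl ccl.
have dist_cvg (u v : nat -> 'rV[R]_q) (ul vl : 'rV[R]_q) :
    u @ \oo --> ul -> v @ \oo --> vl ->
    (fun j => rho / 2 * normF (u j - v j) ^+ 2) @ \oo -->
      rho / 2 * normF (ul - vl) ^+ 2.
  move=> uul vvl; apply: cvgM; first exact: cvg_cst.
  rewrite sqr_normF; under eq_cvg do rewrite sqr_normF.
  by apply: cvg_frob; apply: cvgB.
have [|p pmin] := solv k (2 * rho) (2^-1 *: (cl + bl)); first by rewrite mulr_gt0.
have pE z : ell k p + rho / 2 * normF (p - cl) ^+ 2 + rho / 2 * normF (p - bl) ^+ 2
    <= ell k z + rho / 2 * normF (z - cl) ^+ 2 + rho / 2 * normF (z - bl) ^+ 2.
  have := pmin z; rewrite /prox_objective.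
  have E u : 2 * rho / 2 * normF (u - 2^-1 *: (cl + bl)) ^+ 2 =
      rho / 2 * normF (u - cl) ^+ 2 + rho / 2 * normF (u - bl) ^+ 2
      - rho / 4 * frob (cl - bl) (cl - bl).
    rewrite !sqr_normF !frob_bilin (frobC cl u) (frobC bl u) (frobC bl cl); lra.
  by rewrite !E; lra.
have bl_p : p = bl.
  apply/eqP; rewrite -subr_eq0; apply/eqP/frob_eq0.
  (* Minimality of [b j] tested at [p], added to [pE] at [b j], cancels the values of [ell k] and
     bounds [rho / 2 |p - bl|^2] by [s j], which tends to 0. *)
  pose s j := rho / 2 * normF (p - c j) ^+ 2 - rho / 2 * normF (p - cl) ^+ 2
    + rho / 2 * normF (b j - cl) ^+ 2 - rho / 2 * normF (b j - c j) ^+ 2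
    + rho / 2 * normF (b j - bl) ^+ 2.
  have s_cvg : s @ \oo --> rho / 2 * normF (p - cl) ^+ 2
    - rho / 2 * normF (p - cl) ^+ 2
    + rho / 2 * normF (bl - cl) ^+ 2 - rho / 2 * normF (bl - cl) ^+ 2
    + rho / 2 * normF (bl - bl) ^+ 2.
    apply: cvgD; last by apply: dist_cvg => //; exact: cvg_cst.
    apply: cvgB; last exact: dist_cvg.
    apply: cvgD; last by apply: dist_cvg => //; exact: cvg_cst.
    by apply: cvgB; apply: dist_cvg => //; exact: cvg_cst.
  have : rho / 2 * normF (p - bl) ^+ 2 <= rho / 2 * normF (bl - bl) ^+ 2.
    have := cvgr_to_ge s_cvg (b := rho / 2 * normF (p - bl) ^+ 2).
    rewrite subrr add0r subrr add0r; apply.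
    near=> j; rewrite /s.
    have bj : is_argmin (prox_objective ell k rho (c j)) (b j) by near: j.
    have := bj p; rewrite /prox_objective.
    by have := pE (b j); lra.
  by rewrite subrr !sqr_normF frob0r mulr0 pmulr_rle0 // divr_gt0.
(* The lower bound is [pE] at [b j] with [p = bl]; the upper bound is minimality of [b j] tested at
   [bl]. *)
pose lo j := ell k bl + (rho / 2 * normF (bl - cl) ^+ 2
  - rho / 2 * normF (b j - cl) ^+ 2 - rho / 2 * normF (b j - bl) ^+ 2).
pose hi j := ell k bl + (rho / 2 * normF (bl - c j) ^+ 2
  - rho / 2 * normF (b j - c j) ^+ 2).
apply: (@squeeze_cvgr _ _ _ _ lo hi).
- near=> j; rewrite /lo /hi /=.
  have bj : is_argmin (prox_objective ell k rho (c j)) (b j) by near: j.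
  have := bj bl; rewrite /prox_objective.
  have := pE (b j); rewrite bl_p [bl - bl]subrr (sqr_normF 0) frob0r mulr0.
  by move=> ? ?; apply/andP; split; lra.
- rewrite -[X in _ --> X]addr0; apply: cvgD; first exact: cvg_cst.
  have -> : 0 = rho / 2 * normF (bl - cl) ^+ 2 - rho / 2 * normF (bl - cl) ^+ 2
      - rho / 2 * normF (bl - bl) ^+ 2.
    by rewrite [bl - bl]subrr (sqr_normF 0) frob0r mulr0 subr0 subrr.
  apply: cvgB; last by apply: dist_cvg => //; exact: cvg_cst.
  apply: cvgB; first exact: cvg_cst.
  by apply: dist_cvg => //; exact: cvg_cst.
- rewrite -[X in _ --> X]addr0; apply: cvgD; first exact: cvg_cst.
  rewrite -(subrr (rho / 2 * normF (bl - cl) ^+ 2)).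
  apply: cvgB; last exact: dist_cvg.
  by apply: dist_cvg => //; exact: cvg_cst.
Unshelve. all: by end_near.
Qed.

(** * Sufficient descent *)

(** A bound below along a subsequence bounds the eventually nonincreasing [V] everywhere, so [V]
    converges and its consecutive differences, which dominate [c * d t], vanish. *)
Lemma descent_cvg0 {R : realType} (V d : nat -> R) (N : nat) (c M : R)
    (s : nat -> nat) :
  0 < c -> (forall t, (N <= t)%N -> V t.+1 <= V t - c * d t) ->
  (forall t, 0 <= d t) ->
  (forall k, (k <= s k)%N) -> (\forall k \near \oo, M <= V (s k)) ->
  d @ \oo --> (0 : R).
Proof.
move=> c0 Vdec d0 s_ge [k0 _ VM].
have Vmono i j : (N <= i)%N -> V (i + j)%N <= V i.
  move=> Ni; elim: j => [|j IH]; first by rewrite addn0.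
  rewrite addnS (le_trans _ IH) // (le_trans (Vdec _ _)) ?(leq_trans Ni) ?leq_addr //.
  by rewrite gerBl mulr_ge0 // ltW.
pose W t := V (t + N)%N.
have W_cvg : cvgn W.
  apply: nonincreasing_is_cvgn.
    by move=> i j ij; rewrite /W -(subnK ij) -addnA addnC; apply: Vmono; rewrite leq_addl.
  exists M => _ [t _ <-].
  apply: (le_trans (VM (t + N + k0)%N _)); first by rewrite /= leq_addl.
  rewrite /W.
  rewrite -(subnKC (leq_trans (leq_addr k0 _) (s_ge (t + N + k0)%N))).
  by apply: Vmono; rewrite leq_addl.
have WS_cvg : (fun t => W t.+1) @ \oo --> limn W by rewrite (cvg_shiftS W).
rewrite -(cvg_shiftn N) /=.
apply: (@squeeze_cvgr _ _ _ _ (fun=> 0) (fun t => c^-1 * (W t - W t.+1))).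
- near=> t; rewrite d0 /= ler_pdivlMl //.
  by have := Vdec (t + N)%N; rewrite leq_addl => /(_ isT); rewrite /W addSn; lra.
- exact: cvg_cst.
- rewrite -[X in _ --> X](mulr0 c^-1) -(subrr (limn W)).
  by apply: cvgM; [exact: cvg_cst | exact: cvgB].
Unshelve. all: by end_near.
Qed.

(** * Minimization over alpha of a semiconvex function plus a quadratic penalty *)

Section quadratic_penalty.
Context {R : realType} {n q : nat} (f : 'M[R]_(n, q) -> R) (m : R)
  (K : 'M[R]_n) (rho : R) (b l : 'M[R]_(n, q)).
Implicit Types a x z : 'M[R]_(n, q).

(** On a segment the squared norm lies below its chord by exactly [t (1 - t) |z - x|^2]; this is the
    last term. *)
Lemma semiconvex_segment x z (t : R) : semiconvex m f -> 0 <= t -> t <= 1 ->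
  f (x + t *: (z - x)) <=
    (1 - t) * f x + t * f z + m / 2 * (t * (1 - t)) * frob (z - x) (z - x).
Proof.
move=> fm t0 t1; have := fm (Itv01 t0 t1) z x; rewrite !inE => /(_ I I).
rewrite convRE /=.
have -> : conv (Itv01 t0 t1) (z : convex_lmodType _) x = x + t *: (z - x).
  rewrite /conv /= /unstable.onem.
  by apply/matrixP => i j; rewrite !mxE; ring.
rewrite /unstable.onem !sqr_normF !frob_bilin (frobC z x); lra.
Qed.

(** The part of the augmented Lagrangian that depends on alpha, with [b] for beta and [l] for
    lambda. *)
Definition penalized a : R :=
  f a + frob l (K *m a - b) + rho / 2 * frob (K *m a - b) (K *m a - b).

(** On the segment from [x] to [z] the objective lies below its chord by at least [t (1 - t) D].
    Minimality at [x] then gives growth [(1 - t) D] for every small [t]. *)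
Lemma penalized_min_growth x z : semiconvex m f ->
  (forall a, penalized x <= penalized a) ->
  penalized x + (rho * frob (K *m (z - x)) (K *m (z - x))
                 - m * frob (z - x) (z - x)) / 2 <= penalized z.
Proof.
move=> fm xmin; set D := (_ - _) / 2; rewrite leNgt; apply/negP => zD.
have D0 : 0 < D by have := xmin z; lra.
(* Half the relative shortfall: growth by [(1 - t) D] already contradicts the assumed inequality, so
   no limit in [t] is taken. *)
pose t := (penalized x + D - penalized z) / (2 * D).
have D20 : 0 < 2 * D by rewrite mulr_gt0.
have t0 : 0 < t by apply: divr_gt0 => //; rewrite subr_gt0.
have tD : t * (2 * D) = penalized x + D - penalized z.
  by rewrite /t mulfVK // gt_eqF.
have t1 : t <= 1.
  by rewrite /t ler_pdivrMr // mul1r; have := xmin z; lra.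
have := xmin (x + t *: (z - x)); have := semiconvex_segment x z fm (ltW t0) t1.
have E : penalized (x + t *: (z - x)) = f (x + t *: (z - x))
    - (1 - t) * f x - t * f z - m / 2 * (t * (1 - t)) * frob (z - x) (z - x)
    + (1 - t) * penalized x + t * penalized z - t * (1 - t) * D.
  rewrite /penalized /D.
  have -> : K *m (x + t *: (z - x)) - b =
      (1 - t) *: (K *m x - b) + t *: (K *m z - b).
    rewrite mulmxDr -scalemxAr mulmxBr.
    by apply/matrixP => i j; rewrite !mxE; ring.
  have -> : K *m (z - x) = (K *m z - b) - (K *m x - b).
    by rewrite mulmxBr opprB addrA subrK.
  set u := K *m x - b; set v := K *m z - b; clearbody u v.
  rewrite !frob_bilin (frobC v u); lra.
rewrite E => seg min_seg.
have : 0 <= t * (penalized z - penalized x - (1 - t) * D) by lra.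
by rewrite pmulr_rge0 //; lra.
Qed.

(** The matrix [l + rho *: (K *m x - b)] is the multiplier after its update, so the condition
    involves only the new multiplier. *)
Lemma penalized_min_gradient x : differentiable f x ->
  (forall a, penalized x <= penalized a) ->
  gradient f x = - (K^T *m (l + rho *: (K *m x - b))).
Proof.
move=> df xmin; apply: (gradient_at_min (M := K) (c := rho / 2) df) => z.
have := xmin z; rewrite /penalized.
have -> : K *m z - b = (K *m x - b) + K *m (z - x).
  by rewrite mulmxBr; apply/matrixP => i j; rewrite !mxE; ring.
have -> : frob (K^T *m (l + rho *: (K *m x - b))) (z - x) =
    frob l (K *m (z - x)) + rho * frob (K *m x - b) (K *m (z - x)).
  by rewrite -frob_mulmxr !frob_bilin.
set u := K *m x - b; set v := K *m (z - x); clearbody u v.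
rewrite !frob_bilin (frobC v u); lra.
Qed.

End quadratic_penalty.

(** * The augmented Lagrangian at labelings of finite energy *)

Section augmented_lagrangian.
Context {R : realType} {n q : nat} (ell : 'I_q -> 'rV[R]_q -> R)
  (f : 'M[R]_(n, q) -> R) (K : 'M[R]_n) (CC : {set {set 'I_n}})
  (E : {set 'I_n} -> {ffun 'I_n -> 'I_q} -> \bar R) (En : energies CC E).
Notation labeling := {ffun 'I_n -> 'I_q}.
Implicit Types (y : labeling) (a b l : 'M[R]_(n, q)).

Definition energy y : \bar R := (\sum_(C in CC) E C y)%E.

(** A real-valued version, faithful when the energy is finite; [fine] sends an infinite energy to
    0. *)
Definition real_lagrangian (rho : R) a b l y : R :=
  \sum_(i < n) ell (y i) (row i b) + fine (energy y) + penalized f K rho b l a.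

Lemma energy_fin_or_infty y : energy y \is a fin_num \/ energy y = +oo%E.
Proof.
case: En => E_Ny _; case Ey: (energy y) => [r| |]; [by left | by right |].
move/eqP: Ey; rewrite /energy esum_eqNy => /existsP[C /andP[CCC /eqP EC]].
by have := E_Ny C y CCC; rewrite EC eqxx.
Qed.

Lemma energy_fin_lty y C : energy y \is a fin_num -> C \in CC -> (E C y < +oo)%E.
Proof.
move=> /sum_fin_numP Ey CCC; rewrite ltey.
by have := Ey C (mem_index_enum _) CCC; rewrite fin_numE => /andP[].
Qed.

Lemma aug_lagrangian_fin (rho : R) a b l y : energy y \is a fin_num ->
  aug_lagrangian ell f K CC E rho a b l y = (real_lagrangian rho a b l y)%:E.
Proof.
move=> Ey; rewrite /aug_lagrangian -/(energy y) -(fineK Ey) -!EFinD; congr EFin.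
rewrite /real_lagrangian /penalized sqr_normF; lra.
Qed.

Lemma aug_lagrangian_infty (rho : R) a b l y : energy y = +oo%E ->
  aug_lagrangian ell f K CC E rho a b l y = +oo%E.
Proof. by move=> Ey; rewrite /aug_lagrangian -/(energy y) Ey. Qed.

Lemma row_assemble (B : 'I_n -> 'I_q -> 'rV[R]_q) y i :
  row i (assemble B y) = B i (y i).
Proof. by apply/rowP => j; rewrite !mxE. Qed.

(** Completing the square in [b] merges the multiplier and penalty terms into one square centred at
    [K *m a + rho^-1 *: l], which splits over the rows. *)
Lemma real_lagrangian_prox (rho : R) a b l y : 0 < rho ->
  real_lagrangian rho a b l y =
    \sum_(i < n) prox_objective ell (y i) rho
       (row i (K *m a) + rho^-1 *: row i l) (row i b)
    + fine (energy y) + f a - rho^-1 / 2 * frob l l.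
Proof.
move=> rho0; rewrite /prox_objective big_split /=.
have -> : \sum_(i < n) rho / 2 *
      normF (row i b - (row i (K *m a) + rho^-1 *: row i l)) ^+ 2 =
    rho / 2 * frob (b - (K *m a + rho^-1 *: l)) (b - (K *m a + rho^-1 *: l)).
  rewrite -mulr_sumr frob_rows; congr (_ * _); apply: eq_bigr => i _.
  by rewrite sqr_normF !linearB !linearD !linearZ.
rewrite /real_lagrangian /penalized !frob_bilin.
rewrite (frobC b l) (frobC b (K *m a)) (frobC (K *m a) l).
by field; rewrite gt_eqF.
Qed.

Lemma real_lagrangian_prox_le (rho : R) (B : 'I_n -> 'I_q -> 'rV[R]_q) a b l y :
  0 < rho ->
  (forall i k, is_argmin
     (prox_objective ell k rho (row i (K *m a) + rho^-1 *: row i l)) (B i k)) ->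
  real_lagrangian rho a (assemble B y) l y <= real_lagrangian rho a b l y.
Proof.
move=> rho0 Bmin; rewrite !real_lagrangian_prox // lerD2r lerD2r lerD2r.
by apply: ler_sum => i _; rewrite row_assemble; exact: Bmin.
Qed.

End augmented_lagrangian.

(** * Estimates for one iteration of the algorithm *)

Section admm_iterates.
Context {R : realType} {n q : nat} (ell : 'I_q -> 'rV[R]_q -> R)
  (f : 'M[R]_(n, q) -> R) (K : 'M[R]_n) (CC : {set {set 'I_n}})
  (E : {set 'I_n} -> {ffun 'I_n -> 'I_q} -> \bar R) (En : energies CC E)
  (delta L m sigma tau rho_max : R) (alpha beta lambda : nat -> 'M[R]_(n, q))
  (y yhat : nat -> {ffun 'I_n -> 'I_q}) (rho : nat -> R)
  (B : nat -> 'I_n -> 'I_q -> 'rV[R]_q)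
  (admm : dc_admm ell f K CC E delta L m sigma tau rho_max
            alpha beta lambda y yhat rho B)
  (delta0 : 0 <= delta) (L0 : 0 <= L) (sigma0 : 0 < sigma)
  (K_sym : K^T = K) (f_smooth : smooth L f) (f_semiconvex : semiconvex m f)
  (K_coercive : forall X : 'M[R]_(n, q),
     sigma * frob X X <= frob (K *m X) (K *m X)).
Notation energy := (energy CC E).
Notation real_lagrangian := (real_lagrangian ell f K CC E).

Lemma admm_rho_gt0 t : 0 < rho t.
Proof.
elim: t => [|t rt0]; first exact: admm_rho0 admm.
have [viol ok] := admm_rho admm t.
have [/ok -> //|/viol ->] := pselect (penalty_condition L m sigma (rho t)).
rewrite lt_min (admm_rho_max admm).1 mulr_gt0 //.
exact: lt_trans (admm_tau admm).
Qed.

(** An infinite candidate against a finite label gives the difference +oo and is rejected; a finite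
    candidate against an infinite label gives -oo and is accepted. The label [y 0] may have infinite
    energy, hence the successor. *)
Lemma admm_energy_fin t : energy (y t.+1) \is a fin_num.
Proof.
have := admm_test_defined admm t; rewrite (admm_label admm t).
case: ifP => [acc def|rej def].
- have [//|hatoo] := energy_fin_or_infty En (yhat t.+1).
  move: acc def; rewrite (aug_lagrangian_infty _ _ _ _ _ _ _ hatoo).
  have [fin|yoo] := energy_fin_or_infty En (y t).
    by rewrite (aug_lagrangian_fin _ _ _ _ _ _ _ fin) -EFinN addye // leye_eq.
  by rewrite (aug_lagrangian_infty _ _ _ _ _ _ _ yoo) /adde_def.
- have [//|yoo] := energy_fin_or_infty En (y t).
  move: rej def; rewrite (aug_lagrangian_infty _ _ _ _ _ _ _ yoo).
  have [fin|hatoo] := energy_fin_or_infty En (yhat t.+1).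
    by rewrite (aug_lagrangian_fin _ _ _ _ _ _ _ fin) addeNy // leNye.
  by rewrite (aug_lagrangian_infty _ _ _ _ _ _ _ hatoo) /adde_def.
Qed.

Lemma admm_label_le t :
  real_lagrangian (rho t.+1) (alpha t.+1) (assemble (B t.+2) (y t.+2))
    (lambda t.+1) (y t.+2)
  <= real_lagrangian (rho t.+1) (alpha t.+1) (assemble (B t.+2) (y t.+1))
       (lambda t.+1) (y t.+1).
Proof.
have fin1 := admm_energy_fin t; have fin2 := admm_energy_fin t.+1.
rewrite -lee_fin -!aug_lagrangian_fin //; move: fin2.
rewrite (admm_label admm t.+1); case: ifP => // acc fin2.
move: acc; rewrite !aug_lagrangian_fin // -EFinB !lee_fin.
by move/le_trans/(_ (_ : - delta <= 0)); rewrite oppr_le0 subr_le0; apply.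
Qed.

Lemma admm_penalized_min t a :
  penalized f K (rho t) (beta t.+1) (lambda t) (alpha t.+1)
  <= penalized f K (rho t) (beta t.+1) (lambda t) a.
Proof.
have := admm_alpha admm t a; rewrite !aug_lagrangian_fin ?admm_energy_fin //.
by rewrite lee_fin lerD2l.
Qed.

Lemma admm_gradient t : gradient f (alpha t.+1) = - (K^T *m lambda t.+1).
Proof.
rewrite (admm_lambda admm t).
exact: penalized_min_gradient (f_smooth.1 _) (admm_penalized_min t).
Qed.

(** As [K] is symmetric, [K] applied to the multiplier step is a difference of gradients of [f], to
    which the Lipschitz bound applies. The gradient identity holds only after a step, hence the
    indices. *)
Lemma admm_lambda_le t :
  sigma * frob (lambda t.+2 - lambda t.+1) (lambda t.+2 - lambda t.+1)
  <= L ^+ 2 * frob (alpha t.+2 - alpha t.+1) (alpha t.+2 - alpha t.+1).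
Proof.
apply: le_trans (K_coercive _) _.
have <- : gradient f (alpha t.+1) - gradient f (alpha t.+2) =
    K *m (lambda t.+2 - lambda t.+1).
  by rewrite !admm_gradient K_sym mulmxBr opprK addrC.
have := f_smooth.2 (alpha t.+1) (alpha t.+2).
rewrite -!sqr_normF -exprMn [normF (alpha t.+2 - _)]normF_distC => ?.
by rewrite ler_pXn2r ?nnegrE ?mulr_ge0 ?normF_ge0.
Qed.

(** Four successive changes are added up: beta with the old label, the label, alpha, lambda. Equal
    penalties make both sides values of the same Lagrangian. *)
Lemma admm_descent t : rho t.+1 = rho t.+2 ->
  real_lagrangian (rho t.+2) (alpha t.+2) (beta t.+2) (lambda t.+2) (y t.+2)
  <= real_lagrangian (rho t.+1) (alpha t.+1) (beta t.+1) (lambda t.+1) (y t.+1)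
     + (L ^+ 2 / (rho t.+1 * sigma) + (m - rho t.+1 * sigma) / 2)
       * frob (alpha t.+2 - alpha t.+1) (alpha t.+2 - alpha t.+1).
Proof.
move=> <-; have rho0 := admm_rho_gt0 t.+1; set r := rho t.+1 in rho0 *.
set da := frob (alpha _ - _) _.
have prox_le : real_lagrangian r (alpha t.+1) (assemble (B t.+2) (y t.+1))
      (lambda t.+1) (y t.+1)
    <= real_lagrangian r (alpha t.+1) (beta t.+1) (lambda t.+1) (y t.+1).
  by apply: real_lagrangian_prox_le => // i k; exact: admm_prox admm t.+1 i k.
have label_le := admm_label_le t; rewrite -(admm_beta admm t.+1) -/r in label_le.
have alpha_le : real_lagrangian r (alpha t.+2) (beta t.+2) (lambda t.+1) (y t.+2)
    + (r * sigma - m) / 2 * da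
    <= real_lagrangian r (alpha t.+1) (beta t.+2) (lambda t.+1) (y t.+2).
  have := penalized_min_growth (alpha t.+1) f_semiconvex (admm_penalized_min t.+1).
  have -> : alpha t.+1 - alpha t.+2 = (- 1) *: (alpha t.+2 - alpha t.+1).
    by rewrite scaleN1r opprB.
  rewrite -scalemxAr !frobZl !frobZr -/r -/da.
  have := K_coercive (alpha t.+2 - alpha t.+1); rewrite -/da => Kda.
  rewrite /real_lagrangian => growth.
  have : r * (sigma * da) <=
      r * frob (K *m (alpha t.+2 - alpha t.+1)) (K *m (alpha t.+2 - alpha t.+1)).
    by rewrite ler_pM2l.
  by move: growth; lra.
(* The multiplier step is [r] times the residual, so its pairing with the residual is its squared
   norm over [r]. *)
have lambda_eq : real_lagrangian r (alpha t.+2) (beta t.+2) (lambda t.+2) (y t.+2)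
    = real_lagrangian r (alpha t.+2) (beta t.+2) (lambda t.+1) (y t.+2)
      + r^-1 * frob (lambda t.+2 - lambda t.+1) (lambda t.+2 - lambda t.+1).
  have dl : lambda t.+2 - lambda t.+1 = r *: (K *m alpha t.+2 - beta t.+2).
    by rewrite (admm_lambda admm t.+1) addrAC subrr add0r.
  have -> : lambda t.+2 = lambda t.+1 + r *: (K *m alpha t.+2 - beta t.+2).
    by rewrite -dl subrKC.
  rewrite [lambda t.+1 + _]addrC addrK /real_lagrangian /penalized.
  set u := K *m _ - _; clearbody u; rewrite !frob_bilin.
  rewrite mulKf ?gt_eqF //; lra.
have dl_le : r^-1 * frob (lambda t.+2 - lambda t.+1) (lambda t.+2 - lambda t.+1)
    <= L ^+ 2 / (r * sigma) * da.
  rewrite ler_pdivrMl // invfM -(ler_pM2l sigma0).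
  apply: le_trans (admm_lambda_le t) _; rewrite -/da.
  by rewrite le_eqVlt; apply/orP; left; apply/eqP; field; rewrite !gt_eqF.
rewrite lambda_eq; lra.
Qed.

End admm_iterates.

(** * Subsequences and the passage to the limit *)

(** Labels live in a discrete space, so they are eventually equal to [ys]. Indices are written as
    successors to make each term the output of iteration [r k]. *)
Lemma limit_point_subsequence {R : realType} {n q : nat}
    (alpha beta lambda : nat -> 'M[R]_(n, q)) (y : nat -> {ffun 'I_n -> 'I_q})
    (alphas betas lambdas : 'M[R]_(n, q)) (ys : {ffun 'I_n -> 'I_q}) (N : nat) :
  limit_point_of
    (fun t : nat => (alpha t, beta t, lambda t, y t)
       : ('M[R]_(n, q) * 'M[R]_(n, q) * 'M[R]_(n, q)
          * discrete_topology {ffun 'I_n -> 'I_q})%type)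
    (alphas, betas, lambdas, ys) ->
  exists r : nat -> nat,
    [/\ forall k, [/\ (N <= r k)%N, (k <= r k)%N & y (r k).+1 = ys],
        (fun k => alpha (r k).+1) @ \oo --> alphas,
        (fun k => beta (r k).+1) @ \oo --> betas
      & (fun k => lambda (r k).+1) @ \oo --> lambdas].
Proof.
move=> [s [s_incr s_cvg]].
have s_ge k : (k <= s k)%N.
  by elim: k => // k IH; exact: leq_ltn_trans IH (s_incr _ _ (ltnSn k)).
have abl : (fun k => (alpha (s k), beta (s k), lambda (s k))) @ \oo -->
    (alphas, betas, lambdas).
  exact: (cvg_comp _ _ s_cvg (cvg_fst (FG := nbhs_filter _))).
have ab : (fun k => (alpha (s k), beta (s k))) @ \oo --> (alphas, betas).
  exact: (cvg_comp _ _ abl (cvg_fst (FG := nbhs_filter _))).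
have [k0 _ ys_eq] : \forall k \near \oo, y (s k) = ys.
  have ys_nbhs : nbhs (ys : discrete_topology {ffun 'I_n -> 'I_q}) [set ys].
    by rewrite nbhs_principalE.
  exact: (cvg_comp _ _ s_cvg (cvg_snd (FF := nbhs_filter _)) _ ys_nbhs).
(* The shift passes [k0] to fix the label and [N] for the lower bound; the extra 1 keeps [s (k + M)]
   positive, so its predecessor is genuine. *)
pose M := (k0 + N).+1; pose r k := (s (k + M)%N).-1.
have rS k : (r k).+1 = s (k + M)%N.
  by rewrite prednK // (leq_trans _ (s_ge _)) // addnS.
have shift (u : nat -> 'M[R]_(n, q)) (l : 'M[R]_(n, q)) :
    (fun k => u (s k)) @ \oo --> l -> (fun k => u (r k).+1) @ \oo --> l.
  by rewrite -(cvg_shiftn M) => ul; under eq_cvg do rewrite rS.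
exists r; split.
- move=> k; have rk : (k + (k0 + N) <= r k)%N by rewrite -ltnS rS -addnS.
  rewrite rS (leq_trans _ rk) ?addnA ?leq_addl //.
  rewrite (leq_trans _ rk) ?leq_addr //; split=> //.
  by apply: ys_eq; rewrite /= /M -addSnnS addnCA leq_addr.
- by apply: shift; exact: (cvg_comp _ _ ab (cvg_fst (FG := nbhs_filter _))).
- by apply: shift; exact: (cvg_comp _ _ ab (cvg_snd (FF := nbhs_filter _))).
- by apply: shift; exact: (cvg_comp _ _ abl (cvg_snd (FF := nbhs_filter _))).
Qed.

Lemma trmx_kernel_mx {R : realType} {n : nat} {H : lmodType R}
    (ip : {dot H for idfun}) (phi : 'I_n -> H) :
  (kernel_mx ip phi)^T = kernel_mx ip phi.
Proof. by apply/matrixP => i j; rewrite !mxE hermC expr0 mul1r. Qed.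

Lemma smooth_gradient_cvg {R : realType} {p q : nat} (L : R)
    (f : 'M[R]_(p, q) -> R) (u : nat -> 'M[R]_(p, q)) (x : 'M[R]_(p, q)) :
  0 <= L -> smooth L f -> u @ \oo --> x ->
  (fun k => gradient f (u k)) @ \oo --> gradient f x.
Proof.
move=> L0 [_ fL] ux; apply: cvg_mx_frob0.
apply: (@squeeze_cvgr _ _ _ _ (fun=> 0)
  (fun k => L ^+ 2 * frob (u k - x) (u k - x))).
- apply: nearW => k; rewrite frob_ge0 -!sqr_normF -exprMn.
  by rewrite ler_pXn2r ?nnegrE ?mulr_ge0 ?normF_ge0 //; exact: fL.
- exact: cvg_cst.
- rewrite -[X in _ --> X](mulr0 (L ^+ 2)) -(frob0r (x - x)).
  rewrite -[X in frob _ X](subrr x).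
  apply: cvgM; first exact: cvg_cst.
  by apply: cvg_frob; apply: cvgB => //; exact: cvg_cst.
Qed.

(** * Criticality of limit points *)

Theorem proposition1 (R : realType) (n q : nat)
    (CC : {set {set 'I_n}})
    (E : {set 'I_n} -> {ffun 'I_n -> 'I_q} -> \bar R)
    (ell : 'I_q -> 'rV[R]_q -> R)
    (H : lmodType R) (ip : {dot H for idfun}) (phi : 'I_n -> H)
    (h : R -> R)
    (delta L m sigma tau rho_max rhobar : R)
    (alpha beta lambda : nat -> 'M[R]_(n, q))
    (y yhat : nat -> {ffun 'I_n -> 'I_q})
    (rho : nat -> R) (B : nat -> 'I_n -> 'I_q -> 'rV[R]_q)
    (alphas betas lambdas : 'M[R]_(n, q)) (ys : {ffun 'I_n -> 'I_q}) :
  let K : 'M[R]_n := kernel_mx ip phi in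
  let f : 'M[R]_(n, q) -> R := regularizer ip phi h in
  energies CC E ->
  (forall r s : R, 0 <= r -> r < s -> h r < h s) ->
  0 <= delta ->
  (* (A1) *)
  lower_bounded f -> 0 <= L -> smooth L f -> 0 < m -> semiconvex m f ->
  (* (A2) *)
  (forall k : 'I_q, lower_bounded (ell k)) ->
  (* (A3) *)
  (forall b : 'cV[R]_n, exists a : 'cV[R]_n, K *m a = b) ->
  is_smallest_eigenvalue (K^T *m K) sigma -> 0 < sigma ->
  (* the algorithm *)
  prox_solvable ell ->
  dc_admm ell f K CC E delta L m sigma tau rho_max
    alpha beta lambda y yhat rho B ->
  (* (A4) *)
  (exists T0 : nat, (1 <= T0)%N /\ forall t : nat, (T0 <= t)%N -> rho t = rhobar) ->
  penalty_condition L m sigma rhobar ->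
  limit_point_of
    (fun t : nat => (alpha t, beta t, lambda t, y t)
       : ('M[R]_(n, q) * 'M[R]_(n, q) * 'M[R]_(n, q)
          * discrete_topology {ffun 'I_n -> 'I_q})%type)
    (alphas, betas, lambdas, ys) ->
  dc_critical_point ell f K CC E alphas betas lambdas ys.
Proof.
move=> K f En _ delta0 f_lb L0 f_smooth _ f_semiconvex ell_lb _ sigma_min sigma0.
move=> solv admm [T0 [T0_gt0 rhoE]] pen lim.
have K_sym : K^T = K := trmx_kernel_mx ip phi.
have K_coercive (X : 'M[R]_(n, q)) : sigma * frob X X <= frob (K *m X) (K *m X).
  exact: smallest_eigenvalue_mulmx.
clearbody f.
have [r [rP al_cvg be_cvg la_cvg]] := limit_point_subsequence T0 lim.
have r_ge k : (T0 <= r k)%N by case: (rP k).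
have k_le_r k : (k <= r k)%N by case: (rP k).
have yr k : y (r k).+1 = ys by case: (rP k).
have rho0 : 0 < rhobar by rewrite -(rhoE T0 (leqnn _)) (admm_rho_gt0 admm).
have r_cvg : r @ \oo --> \oo.
  move=> A [k0 _ kA]; exists k0 => // k /= kk; apply: kA => /=.
  exact: leq_trans kk (k_le_r k).
pose d t := frob (alpha t.+1 - alpha t) (alpha t.+1 - alpha t).
have lambda_le t : (T0 <= t)%N ->
    sigma * frob (lambda t.+1 - lambda t) (lambda t.+1 - lambda t) <= L ^+ 2 * d t.
  (* Since [T0] is at least 1, [t] is a successor and the gradient identity is available at both
     ends of the step. *)
  move=> T0t; have := leq_trans T0_gt0 T0t; case: t {T0t} => // t _.
  exact: (admm_lambda_le En admm L0 K_sym f_smooth K_coercive).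
pose V t := real_lagrangian ell f K CC E (rho t) (alpha t) (beta t) (lambda t) (y t).
pose c := - (L ^+ 2 / (rhobar * sigma) + (m - rhobar * sigma) / 2).
have V_descent t : (T0 <= t)%N -> V t.+1 <= V t - c * d t.
  move=> T0t; have := leq_trans T0_gt0 T0t; case: t T0t => // t T0t _.
  have := admm_descent En admm delta0 L0 sigma0 K_sym f_smooth f_semiconvex
    K_coercive (t := t).
  rewrite /V /c mulNr opprK !rhoE //; last exact: leqW.
  exact.
have res_cvg : (fun k => K *m alpha (r k).+1 - beta (r k).+1) @ \oo -->
    K *m alphas - betas.
  by apply: cvgB => //; exact: cvg_mulmx.
have d0 : d @ \oo --> (0 : R).
  have /choice[e ellE] : forall k, exists e, forall b, e <= ell k b.
    by move=> k; have [e He] := ell_lb k; exists e => b; apply: He; exists b.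
  have [ef fE] := f_lb.
  (* The multiplier term, the only one without an evident lower bound, tends to [w] along the
     subsequence and so eventually exceeds [w - 1]. *)
  pose w := frob lambdas (K *m alphas - betas).
  apply: (@descent_cvg0 _ V d T0 c
    (\sum_(i < n) e (ys i) + fine (energy CC E ys) + ef + (w - 1))
    (fun k => (r k).+1)) => //.
  - by rewrite oppr_gt0.
  - by move=> t; exact: frob_ge0.
  - by move=> k; exact: leqW.
  - have w_cvg : (fun k => frob (lambda (r k).+1)
        (K *m alpha (r k).+1 - beta (r k).+1)) @ \oo --> w by exact: cvg_frob.
    have near_w : \forall k \near \oo,
        w - 1 < frob (lambda (r k).+1) (K *m alpha (r k).+1 - beta (r k).+1).
      by apply: (cvgr_gt w w_cvg); rewrite gtrDl ltrN10.
    apply: filterS near_w => k wk; rewrite /V /real_lagrangian /penalized yr.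
    rewrite rhoE; last exact: leqW.
    have res_ge0 : 0 <= rhobar / 2 * frob (K *m alpha (r k).+1 - beta (r k).+1)
        (K *m alpha (r k).+1 - beta (r k).+1).
      by rewrite mulr_ge0 ?frob_ge0 // divr_ge0 ?ltW.
    have fk : ef <= f (alpha (r k).+1) by apply: fE; exists (alpha (r k).+1).
    have ek : \sum_(i < n) e (ys i) <=
        \sum_(i < n) ell (ys i) (row i (beta (r k).+1)).
      by apply: ler_sum => i _; exact: ellE.
    lra.
have dr0 : (fun k => d (r k)) @ \oo --> (0 : R) by exact: (cvg_comp _ _ r_cvg d0).
have dlambda_cvg : (fun k => lambda (r k).+1 - lambda (r k)) @ \oo -->
    (0 : 'M[R]_(n, q)).
  apply: cvg_mx_frob0; apply: (@squeeze_cvgr _ _ _ _ (fun=> 0)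
    (fun k => sigma^-1 * (L ^+ 2 * d (r k)))).
  - apply: nearW => k; rewrite subr0 frob_ge0 ler_pdivlMl //.
    exact: lambda_le.
  - exact: cvg_cst.
  - rewrite -[X in _ --> X](mulr0 sigma^-1) -[X in _ * X](mulr0 (L ^+ 2)).
    by apply: cvgM; [exact: cvg_cst | apply: cvgM => //; exact: cvg_cst].
have dalpha_cvg : (fun k => alpha (r k).+1 - alpha (r k)) @ \oo -->
    (0 : 'M[R]_(n, q)).
  by apply: cvg_mx_frob0; under eq_cvg do rewrite subr0.
(* The proximal centres at iteration [r k] involve the preceding iterates, which have the same
   limits because the steps vanish. *)
have alpha_cvg : (fun k => alpha (r k)) @ \oo --> alphas.
  rewrite -[X in _ --> X]subr0.
  rewrite (_ : (fun k => _) = (fun k => alpha (r k).+1 -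
    (alpha (r k).+1 - alpha (r k)))); first exact: cvgB.
  by apply/funext => k; rewrite subKr.
have lambda_cvg : (fun k => lambda (r k)) @ \oo --> lambdas.
  rewrite -[X in _ --> X]subr0.
  rewrite (_ : (fun k => _) = (fun k => lambda (r k).+1 -
    (lambda (r k).+1 - lambda (r k)))); first exact: cvgB.
  by apply/funext => k; rewrite subKr.
have feasible : K *m alphas = betas.
  apply/eqP; rewrite -subr_eq0; apply/eqP.
  apply: (cvg_unique (@norm_hausdorff _ _) res_cvg) => /=.
  (* The residual is the multiplier step divided by [rhobar], hence tends to 0. *)
  have <- : (fun k => rhobar^-1 *: (lambda (r k).+1 - lambda (r k))) =
      (fun k => K *m alpha (r k).+1 - beta (r k).+1).
    apply/funext => k; rewrite (admm_lambda admm (r k)) rhoE // addrAC subrr add0r.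
    by rewrite scalerA mulVf ?gt_eqF // scale1r.
  rewrite -[X in _ --> X](scaler0 _ rhobar^-1); exact: cvgZl_tmp.
split=> //.
- move=> i; exists (row i lambdas); last exact: subrr.
  pose b k := row i (beta (r k).+1).
  pose ctr k := row i (K *m alpha (r k)) + rhobar^-1 *: row i (lambda (r k)).
  have b_cvg : b @ \oo --> row i betas by exact: cvg_row.
  have ctr_cvg : ctr @ \oo --> row i betas + rhobar^-1 *: row i lambdas.
    rewrite -feasible; apply: cvgD; first by apply: cvg_row; exact: cvg_mulmx.
    by apply: cvgZl_tmp; exact: cvg_row.
  have b_min k : is_argmin (prox_objective ell (ys i) rhobar (ctr k)) (b k).
    rewrite /b (admm_beta admm) row_assemble yr /ctr -(rhoE _ (r_ge k)).
    exact: admm_prox admm (r k) i (ys i).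
  (* These are the regular subgradients of the proximal steps; feasibility makes them tend to
     [row i lambdas]. *)
  exists b, (fun k => rhobar *: (ctr k - b k)); split=> //.
  + apply: (prox_values_cvg solv rho0 _ b_cvg ctr_cvg).
    by apply: nearW.
  + by move=> k; exact: prox_normal.
  + have -> : row i lambdas =
        rhobar *: (row i betas + rhobar^-1 *: row i lambdas - row i betas).
      by rewrite addrAC subrr add0r scalerA divff ?gt_eqF // scale1r.
    by apply: cvgZl_tmp; exact: cvgB.
- exists (gradient f alphas); first exact: gradient_limiting (f_smooth.1 _).
  apply/eqP; rewrite addr_eq0; apply/eqP.
  apply: (cvg_unique (@norm_hausdorff _ _)
    (smooth_gradient_cvg L0 f_smooth al_cvg)) => /=.
  have -> : (fun k => gradient f (alpha (r k).+1)) =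
      (fun k => - (K^T *m lambda (r k).+1)).
    by apply/funext => k; rewrite (admm_gradient En admm f_smooth).
  by apply: cvgN; exact: cvg_mulmx.
- move=> C CCC; apply: energy_fin_lty CCC.
  (* The limit label is attained at an actual iterate of positive index. *)
  by rewrite -(yr 0%N) (admm_energy_fin En admm).
Qed.
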